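(* For any $(X,Y)\in\{(\Delta,\Gamma),(\Gamma,\Gamma),(\Delta,\Delta)\}$ the following holds. Let $S$ be the weight function of the colored stochastic $X$ vertex with spectral parameter $z_i$, $T$ that of the colored stochastic $Y$ vertex with spectral parameter $z_j$, and $R=R_{XY}$ that of the colored stochastic $X$-$Y$ vertex with spectral parameters $z_i,z_j$, with color set $\mathcal{C}=\{c_{\bar n},\dots,c_{\bar 1},c_0,c_1,\dots,c_n\}$. Then for every choice of colors $a,b,c,d,e,f\in\mathcal{C}$, $$\sum_{g,h,k\in\mathcal{C}} R(a,b,g,k)\,S(g,c,d,h)\,T(k,h,e,f)=\sum_{j,m,l\in\mathcal{C}} T(b,c,j,m)\,S(a,m,l,f)\,R(l,j,d,e).$$
   Context: Parameters: $n\ge1$ is an integer; $q,z_i,z_j$ are indeterminates (equivalently, generic complex numbers for which every denominator is nonzero); $z_i'=q+1-\frac1{z_i}$, $z_j'=q+1-\frac1{z_j}$. The labels are ordered by $\bar n<\dots<\bar 1<0<1<\dots<n$. Any configuration not listed has weight $0$. Ordinary vertices: the weight is a function of the colors (left, top, right, bottom). For every color $x$, $(x,x,x,x)\mapsto 1$, and for all labels $\alpha<\beta$: - colored stochastic $\Gamma$ vertex with parameter $z$: $(c_\alpha,c_\beta,c_\alpha,c_\beta)\mapsto z$, $(c_\beta,c_\alpha,c_\beta,c_\alpha)\mapsto qz$, $(c_\beta,c_\alpha,c_\alpha,c_\beta)\mapsto 1-qz$, $(c_\alpha,c_\beta,c_\beta,c_\alpha)\mapsto 1-z$. - colored stochastic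 $\Delta$ vertex with parameter $z$ (with $z'=q+1-1/z$): $(c_\alpha,c_\beta,c_\alpha,c_\beta)\mapsto z'$, $(c_\beta,c_\alpha,c_\beta,c_\alpha)\mapsto\frac1q z'$, $(c_\beta,c_\beta,c_\alpha,c_\alpha)\mapsto 1-z'$, $(c_\alpha,c_\alpha,c_\beta,c_\beta)\mapsto 1-\frac1q z'$. R-vertices with spectral parameters $z_i,z_j$: the weight is a function of the colors (bottom-left, top-left, top-right, bottom-right). For every color $x$, $(x,x,x,x)\mapsto 1$, and for all labels $\alpha<\beta$: - $\Gamma$-$\Gamma$, with $P=1-(q+1)z_j+qz_iz_j$: $(c_\alpha,c_\beta,c_\alpha,c_\beta)\mapsto\frac{z_i-z_j}{P}$, $(c_\beta,c_\alpha,c_\beta,c_\alpha)\mapsto\frac{q(z_i-z_j)}{P}$, $(c_\beta,c_\alpha,c_\alpha,c_\beta)\mapsto\frac{(1-qz_i)(1-z_j)}{P}$, $(c_\alpha,c_\beta,c_\beta,c_\alpha)\mapsto\frac{(1-z_i)(1-qz_j)}{P}$. - $\Delta$-$\Gamma$: $(c_\alpha,c_\beta,c_\alpha,c_\beta)\mapsto\frac{z_i'+qz_j-(q+1)z_i'z_j}{1-z_i'z_j}$, $(c_\beta,c_\alpha,c_\beta,c_\alpha)\mapsto\frac{q^{-1}z_i'+z_j-(1+q^{-1})z_i'z_j}{1-z_i'z_j}$, $(c_\beta,c_\beta,c_\alpha,c_\alpha)\mapsto\frac{(1-z_i')(1-qz_j)}{1-z_i'z_j}$, $(c_\alpha,c_\alpha,c_\beta,c_\beta)\mapsto\frac{(1-q^{-1}z_i')(1-z_j)}{1-z_i'z_j}$.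 - $\Delta$-$\Delta$, with $Q=q-(q+1)z_i'+z_i'z_j'$: $(c_\alpha,c_\beta,c_\alpha,c_\beta)\mapsto\frac{z_j'-z_i'}{Q}$, $(c_\beta,c_\alpha,c_\beta,c_\alpha)\mapsto\frac{q(z_j'-z_i')}{Q}$, $(c_\beta,c_\alpha,c_\alpha,c_\beta)\mapsto\frac{(1-z_i')(q-z_j')}{Q}$, $(c_\alpha,c_\beta,c_\beta,c_\alpha)\mapsto\frac{(1-z_j')(q-z_i')}{Q}$. *)

(* Defs.v *)
From HB Require Import structures.
From mathcomp Require Import all_boot all_order all_algebra.

Set Implicit Arguments.
Unset Strict Implicit.
Unset Printing Implicit Defensive.

Import GRing.Theory.
Local Open Scope ring_scope.

(* Colors c_(bar n), ..., c_(bar 1), c_0, c_1, ..., c_n, in this order: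
   c_(bar k) is the ordinal n - k and c_k is the ordinal n + k, so the order of
   the labels is the natural order of the ordinals. *)
Definition color (n : nat) : finType := 'I_(2 * n).+1.

(* Vertices of both shapes assign 1 to (x, x, x, x) and, for x < y,
   w1 to (x, y, x, y) and w2 to (y, x, y, x).  They differ in the two remaining
   admissible configurations; every other configuration has weight 0. *)

(* w3 : (y, x, x, y),  w4 : (x, y, y, x)  for x < y *)
Definition crossing_weight (F : fieldType) (n : nat) (w1 w2 w3 w4 : F)
    (a b c d : color n) : F :=
  if [&& a == b, b == c & c == d] then 1
  else if [&& (a < b)%N, c == a & d == b] then w1
  else if [&& (b < a)%N, c == a & d == b] then w2
  else if [&& (b < a)%N, c == b & d == a] then w3
  else if [&& (a < b)%N, c == b & d == a] then w4
  else 0.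

(* w3 : (y, y, x, x),  w4 : (x, x, y, y)  for x < y *)
Definition parallel_weight (F : fieldType) (n : nat) (w1 w2 w3 w4 : F)
    (a b c d : color n) : F :=
  if [&& a == b, b == c & c == d] then 1
  else if [&& (a < b)%N, c == a & d == b] then w1
  else if [&& (b < a)%N, c == a & d == b] then w2
  else if [&& (c < a)%N, b == a & d == c] then w3
  else if [&& (a < c)%N, b == a & d == c] then w4
  else 0.

Inductive vertex_type := Gamma | Delta.

Definition dual_param (F : fieldType) (q z : F) : F := q + 1 - z^-1.

(* Arguments of the weight: left, top, right, bottom. *)
Definition vertex_weight (F : fieldType) (n : nat) (X : vertex_type) (q z : F) :
    color n -> color n -> color n -> color n -> F :=
  match X with
  | Gamma => crossing_weight z (q * z) (1 - q * z) (1 - z)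
  | Delta =>
      let z' := dual_param q z in
      parallel_weight z' (q^-1 * z') (1 - z') (1 - q^-1 * z')
  end.

Inductive vertex_pair := DeltaGamma | GammaGamma | DeltaDelta.

Definition first_type (p : vertex_pair) : vertex_type :=
  match p with
  | GammaGamma => Gamma
  | DeltaGamma | DeltaDelta => Delta
  end.

Definition second_type (p : vertex_pair) : vertex_type :=
  match p with
  | DeltaGamma | GammaGamma => Gamma
  | DeltaDelta => Delta
  end.

Definition R_denom (F : fieldType) (p : vertex_pair) (q zi zj : F) : F :=
  let zi' := dual_param q zi in
  let zj' := dual_param q zj in
  match p with
  | DeltaGamma => 1 - zi' * zj
  | GammaGamma => 1 - (q + 1) * zj + q * zi * zj
  | DeltaDelta => q - (q + 1) * zi' + zi' * zj'
  end.

(* Arguments of the weight: bottom-left, top-left, top-right, bottom-right. *)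
Definition R_weight (F : fieldType) (n : nat) (p : vertex_pair) (q zi zj : F) :
    color n -> color n -> color n -> color n -> F :=
  let zi' := dual_param q zi in
  let zj' := dual_param q zj in
  let D := R_denom p q zi zj in
  match p with
  | DeltaGamma =>
      parallel_weight
        ((zi' + q * zj - (q + 1) * zi' * zj) / D)
        ((q^-1 * zi' + zj - (1 + q^-1) * zi' * zj) / D)
        ((1 - zi') * (1 - q * zj) / D)
        ((1 - q^-1 * zi') * (1 - zj) / D)
  | GammaGamma =>
      crossing_weight
        ((zi - zj) / D)
        (q * (zi - zj) / D)
        ((1 - q * zi) * (1 - zj) / D)
        ((1 - zi) * (1 - q * zj) / D)
  | DeltaDelta =>
      crossing_weight
        ((zj' - zi') / D)
        (q * (zj' - zi') / D)
        ((1 - zi') * (q - zj') / D)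
        ((1 - zj') * (q - zi') / D)
  end.

(* Denominators of the weights of an ordinary vertex: q and z occur inverted
   only in the Delta case (z through z' = q + 1 - 1/z). *)
Definition vertex_denom_neq0 (F : fieldType) (X : vertex_type) (q z : F) : bool :=
  match X with
  | Gamma => true
  | Delta => (q != 0) && (z != 0)
  end.

(* The R-weights have no denominators beyond R_denom and those of the two
   ordinary vertices. *)
Definition denominators_neq0 (F : fieldType) (p : vertex_pair) (q zi zj : F) :
    bool :=
  [&& vertex_denom_neq0 (first_type p) q zi,
      vertex_denom_neq0 (second_type p) q zj
    & R_denom p q zi zj != 0].

(* Main.v *)
(* A weight is a path-continuing term (straight) plus a path-turning term (turn),
   each a coefficient times Kronecker deltas of the colors, so the six sums
   collapse.  Color conservation then makes three of the boundary colors a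
   permutation of the other three, and only the relative order of the latter
   matters: what remains is a finite list of rational identities in q and the
   spectral parameters.  The Delta weights involve z only through z', which may
   therefore be treated as a free variable. *)
Require Import Defs.
From mathcomp Require Import all_boot all_order all_algebra.
From mathcomp Require Import zify ring.
Local Open Scope ring_scope.
Import GRing.Theory.

(** * Vertex weights as sums of Kronecker deltas *)

(** At a monochromatic vertex both delta products equal 1, so its weight 1 is credited to [straight]
    and [turn] is 0 at equal colors. *)
Definition straight {F : fieldType} (w1 w2 : F) (x y : nat) : F :=
  if x == y then 1 else if (x < y)%N then w1 else w2.

Definition turn {F : fieldType} (w3 w4 : F) (x y : nat) : F :=
  if x == y then 0 else if (y < x)%N then w3 else w4.

Ltac eq_cases :=
  repeat match goal with
  | |- context [@eq_op _ ?x ?y] => case: (@eqP _ x y) => ?; try subst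
  end; rewrite ?ltnn /= ?mulr0 ?mulr1 ?mul0r ?mul1r ?addr0 ?add0r //.

Section Weights.
Variables (F : fieldType) (n : nat) (w1 w2 w3 w4 : F).
Implicit Types (a b c d : color n).

Lemma crossing_weightE a b c d :
  crossing_weight w1 w2 w3 w4 a b c d =
  straight w1 w2 a b * (c == a)%:R * (d == b)%:R
  + turn w3 w4 a b * (c == b)%:R * (d == a)%:R.
Proof.
rewrite /crossing_weight /straight /turn -!val_eqE /=.
move: (a : nat) (b : nat) (c : nat) (d : nat) => {a b c d} a b c d.
case: (ltngtP a b) => ?; subst; eq_cases; lia.
Qed.

(** Turning joins [a] to [b] and [c] to [d] here, so the two paths being compared carry the colors
    [a] and [c]. *)
Lemma parallel_weightE a b c d :
  parallel_weight w1 w2 w3 w4 a b c d =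
  straight w1 w2 a b * (c == a)%:R * (d == b)%:R
  + turn w3 w4 a c * (b == a)%:R * (d == c)%:R.
Proof.
rewrite /parallel_weight /straight /turn -!val_eqE /=.
move: (a : nat) (b : nat) (c : nat) (d : nat) => {a b c d} a b c d.
case: (ltngtP a b) => [?|?|<-]; case: (ltngtP a c) => [?|?|<-];
  eq_cases; try lia.
Qed.

(** * Collapsing the sums over internal edges *)

Lemma sum_delta (a : color n) (G : color n -> F) :
  \sum_x (x == a)%:R * G x = G a.
Proof.
rewrite (bigD1 a) //= eqxx mul1r big1 ?addr0 // => x /negPf ->.
by rewrite mul0r.
Qed.

Lemma sum_delta2 (a b : color n) (G : color n -> color n -> F) :
  \sum_x \sum_y (x == a)%:R * (y == b)%:R * G x y = G a b.
Proof.
rewrite -[RHS](sum_delta a (G^~ b)); apply: eq_bigr => x _.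
rewrite -(sum_delta b (G x)) mulr_sumr; apply: eq_bigr => y _.
by rewrite mulrA.
Qed.

Let crossing := @crossing_weight F n w1 w2 w3 w4.
Let parallel := @parallel_weight F n w1 w2 w3 w4.
Let s := straight w1 w2.
Let t := turn w3 w4.

(** In these lemmas the suffix names the summed edges; the deltas leave one term for [straight] and
    one for [turn]. *)
Lemma crossing_sum_cd a b (G : color n -> color n -> F) :
  \sum_c \sum_d crossing a b c d * G c d = s a b * G a b + t a b * G b a.
Proof.
rewrite -(sum_delta2 a b G) -(sum_delta2 b a G) !mulr_sumr -big_split.
apply: eq_bigr => c _; rewrite !mulr_sumr -big_split.
by apply: eq_bigr => d _; rewrite /crossing crossing_weightE /= /s /t; ring.
Qed.

Lemma crossing_sum_d a b c (G : color n -> F) :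
  \sum_d crossing a b c d * G d =
  s a b * (c == a)%:R * G b + t a b * (c == b)%:R * G a.
Proof.
rewrite -(sum_delta a G) -(sum_delta b G) !mulr_sumr -big_split.
by apply: eq_bigr => d _; rewrite /crossing crossing_weightE /= /s /t; ring.
Qed.

Lemma crossing_sum_c a b d (G : color n -> F) :
  \sum_c crossing a b c d * G c =
  s a b * (d == b)%:R * G a + t a b * (d == a)%:R * G b.
Proof.
rewrite -(sum_delta a G) -(sum_delta b G) !mulr_sumr -big_split.
by apply: eq_bigr => c _; rewrite /crossing crossing_weightE /= /s /t; ring.
Qed.

(** The colors [a] and [b] would not determine [c] and [d]: if [a = b], turning leaves a free color.
    Hence the sum over [a] and [d]. *)
Lemma parallel_sum_ad b c (G : color n -> color n -> F) :
  \sum_a \sum_d parallel a b c d * G a d = s c b * G c b + t b c * G b c.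
Proof.
rewrite -(sum_delta2 c b G) -(sum_delta2 b c G) !mulr_sumr -big_split.
apply: eq_bigr => a _; rewrite !mulr_sumr -big_split.
apply: eq_bigr => d _; rewrite /parallel parallel_weightE /= /s /t.
(* The coefficients involve the summed color [a]; they can be rewritten in [b] and [c] only where a
   delta is nonzero. *)
by rewrite (eq_sym c) (eq_sym b); case: (eqVneq a c) => [<-|_];
  case: (eqVneq a b) => [<-|_] /=; ring.
Qed.

Lemma parallel_sum_bc a d (G : color n -> color n -> F) :
  \sum_b \sum_c parallel a b c d * G b c = s a d * G d a + t a d * G a d.
Proof.
rewrite -(sum_delta2 a d G) -(sum_delta2 d a G) !mulr_sumr -big_split.
apply: eq_bigr => b _; rewrite !mulr_sumr -big_split.
apply: eq_bigr => c _; rewrite /parallel parallel_weightE /= /s /t.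
by rewrite !(eq_sym d); case: (eqVneq b d) => [->|_];
  case: (eqVneq c d) => [->|_] /=; ring.
Qed.

Lemma parallel_sum_c a b d (G : color n -> F) :
  \sum_c parallel a b c d * G c =
  s a b * (d == b)%:R * G a + t a d * (b == a)%:R * G d.
Proof.
rewrite -(sum_delta a G) -(sum_delta d G) !mulr_sumr -big_split.
apply: eq_bigr => c _; rewrite /parallel parallel_weightE /= /s /t.
by rewrite (eq_sym d c); case: (eqVneq c d) => [->|_] /=; ring.
Qed.

Lemma parallel_sum_d a b c (G : color n -> F) :
  \sum_d parallel a b c d * G d =
  s a b * (c == a)%:R * G b + t a c * (b == a)%:R * G c.
Proof.
rewrite -(sum_delta b G) -(sum_delta c G) !mulr_sumr -big_split.
by apply: eq_bigr => d _; rewrite /parallel parallel_weightE /= /s /t; ring.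
Qed.

End Weights.

(** * Case analysis on the relative order of boundary colors *)

Lemma ltn_tests (x y : nat) : (x < y)%N ->
  ((x < y)%N = true) * ((y < x)%N = false) * ((x == y) = false)
  * ((y == x) = false).
Proof. by move=> xy; do !split; lia. Qed.

Lemma neq_tests (x y : nat) :
  x != y -> ((x == y) = false) * ((y == x) = false).
Proof. by move=> xy; split; lia. Qed.

Ltac order_cases :=
  repeat match goal with
  | x : nat, y : nat |- _ =>
    assert_fails (constr_eq x y);
    lazymatch goal with
    | _ : is_true (x < y)%N |- _ => fail
    | _ : is_true (y < x)%N |- _ => fail
    | _ => case: (ltngtP x y) => ?; [ | | subst]; try (exfalso; lia)
    end
  end;
  repeat match goal with
  | H : is_true (?x < ?y)%N |- _ => move: H => /ltn_tests ?
  end.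

Ltac simp_tests :=
  repeat match goal with H : (_ * (_ = false))%type |- _ => rewrite !H end;
  rewrite ?eqxx ?ltnn /= ?mulr0n ?mulr1n;
  rewrite ?mulr0 ?mul0r ?mulr1 ?mul1r ?addr0 ?add0r ?mulr0 ?mul0r ?addr0 ?add0r.

Ltac value_case d x :=
  case: (eqVneq d x) => [?|/neq_tests ?];
  [ repeat match goal with
    | H : (((d == _) = false) * _)%type |- _ => clear H
    end; subst d
  | ].

(* A plain [reflexivity] would try to unify distinct sides by unfolding. *)
Ltac syntactic_refl := match goal with |- ?x = ?x => reflexivity end.

(** A color outside [a], [b], [c] violates conservation, so both sides become 0. Each [try] allows
    for a name that [order_cases] has substituted away. *)
Ltac value_cases d a b c :=
  try value_case d a; try value_case d b; try value_case d c;
  simp_tests; try syntactic_refl.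

Ltac color_cases a b c :=
  order_cases; simp_tests;
  let d := fresh "d" in let e := fresh "e" in let f := fresh "f" in
  move=> d e f; value_cases d a b c; value_cases e a b c; value_cases f a b c.

(** * The three Yang-Baxter equations *)

Lemma GammaGamma_YBE (F : fieldType) (n : nat) (q zi zj : F)
    (a b c d e f : color n) :
  R_denom GammaGamma q zi zj != 0 ->
  \sum_(g : color n) \sum_(h : color n) \sum_(k : color n)
     R_weight GammaGamma q zi zj a b g k * vertex_weight Gamma q zi g c d h *
       vertex_weight Gamma q zj k h e f =
  \sum_(j : color n) \sum_(m : color n) \sum_(l : color n)
     vertex_weight Gamma q zj b c j m * vertex_weight Gamma q zi a m l f *
       R_weight GammaGamma q zi zj l j d e.
Proof.
rewrite /R_weight /vertex_weight /R_denom.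
(* The R-weights stay opaque during the case analysis and are unfolded only for [field]. *)
set D := (X in X != 0) => D0.
set r1 := _ / D; set r2 := _ / D; set r3 := _ / D; set r4 := _ / D.
(* On each side the edge shared by the last two factors is summed first; then the first factor fixes
   the other two edges. *)
under eq_bigr => g _.
  rewrite exchange_big /=; under eq_bigr => k _.
    under eq_bigr => h _ do rewrite -mulrA.
    rewrite -mulr_sumr crossing_sum_d; over.
  over.
rewrite crossing_sum_cd.
under [RHS]eq_bigr => j _.
  under eq_bigr => m _.
    under eq_bigr => l _ do rewrite -mulrA.
    rewrite -mulr_sumr crossing_sum_c; over.
  over.
rewrite crossing_sum_cd.
rewrite !crossing_weightE -!val_eqE /=.
(* Color conservation pairs (a, b, c) with (d, e, f): the first three get ordered, the others are
   compared with them. *)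
move: (a : nat) (b : nat) (c : nat) (d : nat) (e : nat) (f : nat).
rewrite /straight /turn => {n a b c d e f} a b c.
by color_cases a b c; rewrite /r1 /r2 /r3 /r4 /D; field.
Qed.

Lemma DeltaGamma_YBE (F : fieldType) (n : nat) (q zi zj : F)
    (a b c d e f : color n) :
  q != 0 -> R_denom DeltaGamma q zi zj != 0 ->
  \sum_(g : color n) \sum_(h : color n) \sum_(k : color n)
     R_weight DeltaGamma q zi zj a b g k * vertex_weight Delta q zi g c d h *
       vertex_weight Gamma q zj k h e f =
  \sum_(j : color n) \sum_(m : color n) \sum_(l : color n)
     vertex_weight Gamma q zj b c j m * vertex_weight Delta q zi a m l f *
       R_weight DeltaGamma q zi zj l j d e.
Proof.
rewrite /R_weight /vertex_weight /R_denom /=; move: (dual_param q zi) => x.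
move=> q0; set D := (X in X != 0) => D0.
set r1 := _ / D; set r2 := _ / D; set r3 := _ / D; set r4 := _ / D.
(* The outer sum runs over [g] and [h], which [c] and [d] fix at the Delta vertex; its weight is
   therefore pulled out of the sum over [k]. *)
under eq_bigr => g _.
  under eq_bigr => h _.
    under eq_bigr => k _ do rewrite [_ * parallel_weight _ _ _ _ g c d h]mulrC -mulrA.
    rewrite -mulr_sumr parallel_sum_d; over.
  over.
rewrite parallel_sum_ad.
under [RHS]eq_bigr => j _.
  under eq_bigr => m _.
    under eq_bigr => l _ do rewrite -mulrA.
    rewrite -mulr_sumr parallel_sum_c; over.
  over.
rewrite crossing_sum_cd.
rewrite !crossing_weightE !parallel_weightE -!val_eqE /=.
move: (b : nat) (c : nat) (d : nat) (a : nat) (e : nat) (f : nat).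
(* Color conservation here pairs (a, e, f) with (b, c, d). *)
rewrite /straight /turn => {n a b c d e f} b c d.
by color_cases b c d; rewrite /r1 /r2 /r3 /r4 /D; field; do ?[apply/andP; split].
Qed.

Lemma DeltaDelta_YBE (F : fieldType) (n : nat) (q zi zj : F)
    (a b c d e f : color n) :
  q != 0 -> R_denom DeltaDelta q zi zj != 0 ->
  \sum_(g : color n) \sum_(h : color n) \sum_(k : color n)
     R_weight DeltaDelta q zi zj a b g k * vertex_weight Delta q zi g c d h *
       vertex_weight Delta q zj k h e f =
  \sum_(j : color n) \sum_(m : color n) \sum_(l : color n)
     vertex_weight Delta q zj b c j m * vertex_weight Delta q zi a m l f *
       R_weight DeltaDelta q zi zj l j d e.
Proof.
rewrite /R_weight /vertex_weight /R_denom /=.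
move: (dual_param q zi) (dual_param q zj) => x y.
move=> q0; set D := (X in X != 0) => D0.
set r1 := _ / D; set r2 := _ / D; set r3 := _ / D; set r4 := _ / D.
under eq_bigr => g _.
  under eq_bigr => h _.
    under eq_bigr => k _ do rewrite [_ * parallel_weight _ _ _ _ g c d h]mulrC -mulrA.
    rewrite -mulr_sumr crossing_sum_d; over.
  over.
rewrite parallel_sum_ad.
(* Both ordinary vertices are parallel: [a] and [f] fix [m] and [l], so the sum over [j] is moved
   innermost. *)
under [RHS]eq_bigr => j _.
  under eq_bigr => m _.
    under eq_bigr => l _ do rewrite [_ * parallel_weight _ _ _ _ a m l f]mulrC -mulrA.
    over.
  over.
rewrite [RHS]exchange_big /=.
under [RHS]eq_bigr => m _.
  rewrite exchange_big /=; under eq_bigr => l _.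
    rewrite -mulr_sumr parallel_sum_c; over.
  over.
rewrite parallel_sum_bc.
rewrite !crossing_weightE !parallel_weightE -!val_eqE /=.
move: (a : nat) (b : nat) (f : nat) (c : nat) (d : nat) (e : nat).
(* Color conservation here pairs (c, d, e) with (a, b, f). *)
rewrite /straight /turn => {n a b c d e f} a b f.
by color_cases a b f; rewrite /r1 /r2 /r3 /r4 /D; field; do ?[apply/andP; split].
Qed.

Theorem theorem3p1 (F : fieldType) (n : nat) (hn : (1 <= n)%N)
    (q zi zj : F) (p : vertex_pair) (hden : denominators_neq0 p q zi zj)
    (a b c d e f : color n) :
  let S := @vertex_weight F n (first_type p) q zi in
  let T := @vertex_weight F n (second_type p) q zj in
  let R := @R_weight F n p q zi zj in
  \sum_(g : color n) \sum_(h : color n) \sum_(k : color n)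
     R a b g k * S g c d h * T k h e f =
  \sum_(j : color n) \sum_(m : color n) \sum_(l : color n)
     T b c j m * S a m l f * R l j d e.
Proof.
move=> S T R; case: p hden @S @T @R => /and3P[/= + +].
- by move=> /andP[q0 _] _; exact: DeltaGamma_YBE.
- by move=> _ _; exact: GammaGamma_YBE.
- by move=> /andP[q0 _] _; exact: DeltaDelta_YBE.
Qed.
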